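(* Let $N$ be the place-transition net with places $p_1,\dots,p_8$ and transitions $t_1,\dots,t_6$, whose arcs (all of multiplicity $1$ unless stated otherwise) are: $t_1$: input $p_1$; output $p_5$ with multiplicity $2$. $t_2$: inputs $p_4, p_5$; output $p_6$. $t_3$: inputs $p_4, p_5, p_8$; outputs $p_7, p_8$. $t_4$: input $p_6$ with multiplicity $2$; outputs $p_2$ and $p_4$ with multiplicity $2$. $t_5$: inputs $p_5, p_6$; outputs $p_3, p_4$. $t_6$: inputs $p_5, p_7$; outputs $p_3, p_4$. Let $x \geq 1$ be an integer and consider the initial marking $\{p_1, x\cdot p_4, p_8\}$ (one token in $p_1$, $x$ tokens in $p_4$, one token in $p_8$, no other tokens). Run $N$ as a strong Sleptsov net. Then every run of the net from this initial marking terminates (reaches a marking in which no transition is firable), and the terminal marking is $\{p_2, x\cdot p_4, p_8\}$ if $x>1$, and $\{p_3, x\cdot p_4, p_8\}$ if $x=1$. Thus, if a register with nonnegative integer value $v$ is stored in place $p_4$ as the marking $x=v+1$, the net, started by a token in $p_1$, puts a token into $p_3$ exactly when $v=0$ and into $p_2$ exactly when $v>0$, leaving the register unchanged.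
   Context: A place-transition net is $N=(P,T,A,\mu_0)$ with finite place set $P$, finite transition set $T$, arc multiplicities $A: P\times T \cup T\times P \to \mathbb{Z}_{\geq 0}$ (writing $a(p,t)$, $a(t,p)$), and markings $\mu: P\to\mathbb{Z}_{\geq 0}$, $\mu_0$ initial. The firability multiplicity of transition $t$ in marking $\mu$ is $c(t)=\min_{p: a(p,t)>0} \lfloor \mu(p)/a(p,t)\rfloor$; $t$ is firable if $c(t)>0$. In a strong Sleptsov net, at each step one firable transition $t$ whose $c(t)$ is maximal among all transitions is chosen (nondeterministically if several have the same maximal value) and fires $c(t)$ times at once: $\mu'(p)=\mu(p)-c(t)\,a(p,t)+c(t)\,a(t,p)$ for all $p\in P$. The net of the claim is the paper's zero-check net given in a figure; its arcs are as reconstructed from the firing sequences described in the paper's proof. *)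

(* Defs.v *)
From HB Require Import structures.
From mathcomp Require Import all_boot.

Set Implicit Arguments.
Unset Strict Implicit.
Unset Printing Implicit Defensive.

Record ptnet (P T : finType) : Type := PTNet {
  pre : P -> T -> nat;
  post : T -> P -> nat;
  init : {ffun P -> nat}
}.

Section StrongSleptsov.

Variables (P T : finType) (N : ptnet P T).
Implicit Types (mu : {ffun P -> nat}) (t : T).

(* The minimum of mu(p) %/ a(p,t) over the input places p of t. The seed of   *)
(* the iterated minn is itself one of the values, so it does not affect the   *)
(* result. The minimum is undefined when t has no input place; such a t gets  *)
(* the junk value 0.                                                          *)
Definition fire_mult mu t : nat :=
  if [pick p | 0 < pre N p t] is Some p0 then
    \big[minn/mu p0 %/ pre N p0 t]_(p | 0 < pre N p t) (mu p %/ pre N p t)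
  else 0.

Definition firable mu t : bool := 0 < fire_mult mu t.

(* The truncated subtraction is exact: fire_mult mu t * pre N p t <= mu p.    *)
Definition fire mu t : {ffun P -> nat} :=
  [ffun p => mu p - fire_mult mu t * pre N p t + fire_mult mu t * post N t p].

Definition sstep : rel {ffun P -> nat} := fun mu mu' =>
  [exists t, [&& firable mu t,
                 [forall u, fire_mult mu u <= fire_mult mu t]
               & mu' == fire mu t]].

Definition terminal mu : bool := [forall t, ~~ firable mu t].

(* A finite run is given by the markings that follow the initial one. *)
Definition finite_run (s : seq {ffun P -> nat}) : bool := path sstep (init N) s.

Definition final_marking (s : seq {ffun P -> nat}) : {ffun P -> nat} :=
  last (init N) s.

Definition maximal_run (s : seq {ffun P -> nat}) : Prop :=
  finite_run s /\ forall mu, ~~ sstep (final_marking s) mu.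

Definition infinite_run (r : nat -> {ffun P -> nat}) : Prop :=
  r 0 = init N /\ forall n, sstep (r n) (r n.+1).

(* There is no infinite run, and every run that cannot be continued has       *)
(* reached a marking in which no transition is firable.                       *)
Definition every_run_terminates : Prop :=
  (~ exists r, infinite_run r) /\
  (forall s, maximal_run s -> terminal (final_marking s)).

End StrongSleptsov.

Inductive place := p1 | p2 | p3 | p4 | p5 | p6 | p7 | p8.

Definition place_ord (p : place) : 'I_8 :=
  match p with
  | p1 => @Ordinal 8 0 isT | p2 => @Ordinal 8 1 isT
  | p3 => @Ordinal 8 2 isT | p4 => @Ordinal 8 3 isT
  | p5 => @Ordinal 8 4 isT | p6 => @Ordinal 8 5 isT
  | p7 => @Ordinal 8 6 isT | p8 => @Ordinal 8 7 isT
  end.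

Definition ord_place (i : 'I_8) : place :=
  nth p1 [:: p1; p2; p3; p4; p5; p6; p7; p8] i.

Lemma place_ordK : cancel place_ord ord_place. Proof. by case. Qed.

HB.instance Definition _ := Finite.copy place (can_type place_ordK).

Inductive trans := t1 | t2 | t3 | t4 | t5 | t6.

Definition trans_ord (t : trans) : 'I_6 :=
  match t with
  | t1 => @Ordinal 6 0 isT | t2 => @Ordinal 6 1 isT
  | t3 => @Ordinal 6 2 isT | t4 => @Ordinal 6 3 isT
  | t5 => @Ordinal 6 4 isT | t6 => @Ordinal 6 5 isT
  end.

Definition ord_trans (i : 'I_6) : trans :=
  nth t1 [:: t1; t2; t3; t4; t5; t6] i.

Lemma trans_ordK : cancel trans_ord ord_trans. Proof. by case. Qed.

HB.instance Definition _ := Finite.copy trans (can_type trans_ordK).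

Definition zc_pre (p : place) (t : trans) : nat :=
  match t, p with
  | t1, p1 => 1
  | t2, (p4 | p5) => 1
  | t3, (p4 | p5 | p8) => 1
  | t4, p6 => 2
  | t5, (p5 | p6) => 1
  | t6, (p5 | p7) => 1
  | _, _ => 0
  end.

Definition zc_post (t : trans) (p : place) : nat :=
  match t, p with
  | t1, p5 => 2
  | t2, p6 => 1
  | t3, (p7 | p8) => 1
  | t4, p2 => 1
  | t4, p4 => 2
  | t5, (p3 | p4) => 1
  | t6, (p3 | p4) => 1
  | _, _ => 0
  end.

(* The marking {q, x.p4, p8}, for q other than p4 and p8. *)
Definition zc_marking (q : place) (x : nat) : {ffun place -> nat} :=
  [ffun p => if p == q then 1
             else match p with p4 => x | p8 => 1 | _ => 0 end].

Definition zero_check (x : nat) : ptnet place trans :=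
  PTNet zc_pre zc_post (zc_marking p1 x).

(* Main.v *)
Require Import Defs.
From mathcomp Require Import all_boot order zify.

Set Implicit Arguments.
Unset Strict Implicit.
Unset Printing Implicit Defensive.

Import Order.TTheory.

(** The token of [p1] becomes two tokens in [p5].  If [x > 1], then [t2] has
    multiplicity 2 while [t3] is held to 1 by the single token of [p8], so [t2]
    takes both tokens at once, and [t4] restores [p4] and marks [p2].  If
    [x = 1], then [t2] and [t3] tie with multiplicity 1; either one leaves one
    token in [p5] and one in [p6] or [p7], and then [t5] or [t6], respectively,
    restores [p4] and marks [p3]. *)

Section Normalization.

Variables (S : eqType) (e : rel S).
Implicit Types (x y z : S) (s : seq S).

Definition normal_form x : Prop := forall y, ~~ e x y.

(* Every maximal [e]-path from the first argument is finite and ends in the   *)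
(* second; the premise [e x y] keeps [x] from being a normal form.            *)
Inductive normalizes_to : S -> S -> Prop :=
  | NormalizesRefl x : normal_form x -> normalizes_to x x
  | NormalizesStep x y z : e x y ->
      (forall y', e x y' -> normalizes_to y' z) -> normalizes_to x z.

Lemma normalizes_to_successors x z y s : e x =i y :: s ->
  {in y :: s, forall y', normalizes_to y' z} -> normalizes_to x z.
Proof.
move=> succ_x norm; apply: (@NormalizesStep _ y) => [|y' exy'].
  by rewrite -[e x y]/(y \in e x) succ_x mem_head.
by apply: norm; rewrite -succ_x.
Qed.

Lemma normalizes_to_successor x y z :
  e x =i [:: y] -> normalizes_to y z -> normalizes_to x z.
Proof.
move=> succ_x norm; apply: normalizes_to_successors succ_x _ => y'.
by rewrite inE => /eqP ->.
Qed.

Lemma normalizes_to_no_infinite_path x z (r : nat -> S) :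
  normalizes_to x z -> r 0 = x -> ~ forall n, e (r n) (r n.+1).
Proof.
move=> norm; elim: norm r => {x z} [x nf_x|x y z _ _ IH] r r0 e_r.
  by move: (nf_x (r 1)); rewrite -r0 e_r.
by apply: (IH (r 1) _ (fun n => r n.+1)) => //; rewrite -r0.
Qed.

Lemma normalizes_to_last x z s :
  normalizes_to x z -> path e x s -> normal_form (last x s) -> last x s = z.
Proof.
move=> norm; elim: norm s => {x z} [x nf_x|x y z exy _ IH] [|y' s] //=.
- by rewrite (negbTE (nf_x y')).
- by move=> _ /(_ y); rewrite exy.
- by move=> /andP[/IH]; apply.
Qed.

End Normalization.

Section StrongSleptsovTheory.

Variables (P T : finType) (N : ptnet P T).
Implicit Types (mu nu : {ffun P -> nat}) (t u : T).

Lemma leq_fire_mult mu t k : (exists p, 0 < pre N p t) ->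
  (k <= fire_mult N mu t) = [forall p, k * pre N p t <= mu p].
Proof.
move=> [q pre_q]; rewrite /fire_mult.
case: pickP => [p0 pre_p0|/(_ q)]; last by rewrite pre_q.
rewrite -minEnat -[k <= _]/(k <= _)%O.
apply/bigmin_geP/forallP => [[_ le_k] p|le_k].
  have [->|pre_p] := posnP (pre N p t); first by rewrite muln0.
  by rewrite -leq_divRL //; apply: le_k.
by split=> [|p pre_p]; rewrite leEnat leq_divRL.
Qed.

Lemma sstepP mu nu :
  reflect (exists t, [/\ firable N mu t,
                         forall u, fire_mult N mu u <= fire_mult N mu t
                       & nu = fire N mu t])
          (sstep N mu nu).
Proof.
apply: (iffP existsP) => -[t].
  by case/and3P=> firable_t /forallP max_t /eqP ->; exists t.
case=> firable_t max_t ->; exists t; rewrite firable_t eqxx andbT.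
exact/forallP.
Qed.

Lemma terminalP mu : reflect (normal_form (sstep N) mu) (terminal N mu).
Proof.
apply: (iffP forallP) => [stuck nu|nf_mu t].
  by apply/sstepP => -[t [firable_t _ _]]; move: (stuck t); rewrite firable_t.
apply/negP => firable_t.
have [u _ max_u] := @arg_maxnP _ t xpredT (fire_mult N mu) isT.
move/negP: (nf_mu (fire N mu u)); apply; apply/sstepP; exists u.
by split=> // [|v]; [apply: leq_trans (max_u t _) | apply: max_u].
Qed.

Lemma sstep_argmax mu k ts nus : 0 < k -> ts != [::] ->
  (forall t, fire_mult N mu t <= k ?= iff (t \in ts)) ->
  [seq [ffun p => mu p - k * pre N p t + k * post N t p] | t <- ts] = nus ->
  sstep N mu =i nus.
Proof.
move=> k_gt0 ts_neq0 max_k <- nu.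
have in_ts t : (t \in ts) = (fire_mult N mu t == k).
  by rewrite (eq_leqif (max_k t)).
apply/sstepP/mapP => [[t [_ max_t ->]]|[t]].
- have mult_t : fire_mult N mu t = k.
    case: ts ts_neq0 in_ts {max_k} (max_k t) => // u ts _ in_ts [le_k _].
    have /eqP mult_u : fire_mult N mu u == k by rewrite -in_ts mem_head.
    by apply/eqP; rewrite eqn_leq le_k -mult_u max_t.
  by exists t; rewrite ?in_ts /fire mult_t.
- rewrite in_ts => /eqP mult_t ->; exists t; rewrite /firable /fire mult_t.
  by split=> // u; apply: max_k.
Qed.

Lemma normalizes_to_init nu : normalizes_to (sstep N) (init N) nu ->
  every_run_terminates N /\ forall s, maximal_run N s -> final_marking N s = nu.
Proof.
move=> norm; split=> [|s [run_s nf_s]]; last first.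
  exact: normalizes_to_last norm run_s nf_s.
split=> [[r [r0 run_r]]|s [_ /terminalP]//].
exact: normalizes_to_no_infinite_path norm r0 run_r.
Qed.

End StrongSleptsovTheory.

Definition zc_marking2 q r y : {ffun place -> nat} :=
  [ffun p => zc_marking q y p + (p == r)].

(* [zc_firing mu k ts nus]: the largest multiplicity in [mu] is [k], attained *)
(* exactly by the transitions in [ts], whose firings give [nus] in that order. *)
Variant zc_firing : {ffun place -> nat} -> nat -> seq trans ->
    seq {ffun place -> nat} -> Prop :=
  | ZcFireT1 y :
      zc_firing (zc_marking p1 y) 1 [:: t1] [:: zc_marking2 p5 p5 y]
  | ZcFireT2 y :
      zc_firing (zc_marking2 p5 p5 y.+2) 2 [:: t2] [:: zc_marking2 p6 p6 y]
  | ZcFireT4 y :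
      zc_firing (zc_marking2 p6 p6 y) 1 [:: t4] [:: zc_marking p2 y.+2]
  | ZcFireT2T3 :
      zc_firing (zc_marking2 p5 p5 1) 1 [:: t2; t3]
        [:: zc_marking2 p5 p6 0; zc_marking2 p5 p7 0]
  | ZcFireT5 :
      zc_firing (zc_marking2 p5 p6 0) 1 [:: t5] [:: zc_marking p3 1]
  | ZcFireT6 :
      zc_firing (zc_marking2 p5 p7 0) 1 [:: t6] [:: zc_marking p3 1].

Section ZeroCheckRuns.

Variable x : nat.

Lemma zc_fire_mult mu t : fire_mult (zero_check x) mu t =
  match t with
  | t1 => mu p1
  | t2 => minn (mu p4) (mu p5)
  | t3 => minn (minn (mu p4) (mu p5)) (mu p8)
  | t4 => mu p6 %/ 2
  | t5 => minn (mu p5) (mu p6)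
  | t6 => minn (mu p5) (mu p7)
  end.
Proof.
apply/eqP/eq_geP => k; rewrite !leEnat leq_fire_mult; last first.
  by case: t; [exists p1|exists p4|exists p4|exists p6|exists p5|exists p5].
apply/forallP/idP => [le_k|le_k p].
  move: (le_k p1) (le_k p4) (le_k p5) (le_k p6) (le_k p7) (le_k p8).
  by case: t {le_k} => /=; lia.
by case: t le_k; case: p => /=; lia.
Qed.

Lemma zc_firing_sstep mu k ts nus :
  zc_firing mu k ts nus -> sstep (zero_check x) mu =i nus.
Proof.
move=> edge; apply: (@sstep_argmax _ _ _ _ k ts).
- by case: edge.
- by case: edge.
- by case: edge => [y|y|y|||] []; apply/leqifP;
    rewrite zc_fire_mult !ffunE //=; lia.
- by case: edge => [y|y|y|||]; do !congr (_ :: _); apply/ffunP; case;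
    rewrite !ffunE //=; lia.
Qed.

Lemma zc_marking_normal_form q y : q \in [:: p2; p3] ->
  normal_form (sstep (zero_check x)) (zc_marking q y).
Proof.
move=> q23; apply/terminalP/forallP => t; rewrite /firable zc_fire_mult.
by case: q q23 => // _; case: t; rewrite !ffunE //=; lia.
Qed.

Lemma zc_normalizes_to_p2 y :
  normalizes_to (sstep (zero_check x))
    (zc_marking p1 y.+2) (zc_marking p2 y.+2).
Proof.
apply: normalizes_to_successor (zc_firing_sstep (ZcFireT1 _)) _.
apply: normalizes_to_successor (zc_firing_sstep (ZcFireT2 _)) _.
apply: normalizes_to_successor (zc_firing_sstep (ZcFireT4 _)) _.
by apply/NormalizesRefl/zc_marking_normal_form.
Qed.

Lemma zc_normalizes_to_p3 :
  normalizes_to (sstep (zero_check x)) (zc_marking p1 1) (zc_marking p3 1).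
Proof.
apply: normalizes_to_successor (zc_firing_sstep (ZcFireT1 _)) _.
apply: normalizes_to_successors (zc_firing_sstep ZcFireT2T3) _ => nu.
rewrite !inE => /pred2P[] ->.
- apply: normalizes_to_successor (zc_firing_sstep ZcFireT5) _.
  by apply/NormalizesRefl/zc_marking_normal_form.
- apply: normalizes_to_successor (zc_firing_sstep ZcFireT6) _.
  by apply/NormalizesRefl/zc_marking_normal_form.
Qed.

End ZeroCheckRuns.

Lemma zero_check_runs x : 0 < x ->
  every_run_terminates (zero_check x) /\
  forall s, maximal_run (zero_check x) s ->
    final_marking (zero_check x) s = zc_marking (if 1 < x then p2 else p3) x.
Proof.
case: x => [|[|y]] // _; apply: normalizes_to_init.
  exact: zc_normalizes_to_p3.
exact: zc_normalizes_to_p2.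
Qed.

Theorem theorem1 :
  (forall x : nat, 1 <= x ->
     every_run_terminates (zero_check x) /\
     forall s : seq {ffun place -> nat}, maximal_run (zero_check x) s ->
       (1 < x -> final_marking (zero_check x) s = zc_marking p2 x) /\
       (x = 1 -> final_marking (zero_check x) s = zc_marking p3 x)) /\
  (forall v : nat,
     every_run_terminates (zero_check v.+1) /\
     forall s : seq {ffun place -> nat}, maximal_run (zero_check v.+1) s ->
       [/\ final_marking (zero_check v.+1) s p3 = (if v == 0 then 1 else 0),
           final_marking (zero_check v.+1) s p2 = (if 0 < v then 1 else 0)
         & final_marking (zero_check v.+1) s p4 = v.+1]).
Proof.
split=> [x /zero_check_runs|v]; last have := @zero_check_runs v.+1 isT.
  by case=> term final; split=> // s /final ->; split=> [->|->].
case=> term final; split=> // s /final ->.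
by case: v {term final} => [|v]; rewrite !ffunE.
Qed.
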